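(* Let $p_0,p_1,p_2,p_3\ge0$ with $\sum_{i=0}^3p_i=1$ and let $\mathcal{N}$ be the Pauli qubit channel $$\mathcal{N}(\rho)=p_0\rho+p_1\sigma_x\rho\sigma_x+p_2\sigma_z\rho\sigma_z+p_3\sigma_y\rho\sigma_y.$$ Then the cv capacity $\mathcal{CV}(\mathcal{N})=\lim_{k\to\infty}\frac1k\log_2\mathrm{cv}(\mathcal{N}^{\otimes k})$ equals $$\mathcal{CV}(\mathcal{N})=\log_2\left(2(q_1+q_2)\right),$$ where $q_1$ and $q_2$ are the two largest among the probabilities $p_0,p_1,p_2,p_3$ (counted with multiplicity).
   Context: $\sigma_x,\sigma_y,\sigma_z$ are the Pauli matrices. Communication value: for a classical channel with transition probabilities $P(y|x)$, $x\in[n]$, $y\in[n']$, put $\mathrm{cv}(\mathbf{P})=\sum_{y\in[n']}\max_{x\in[n]}P(y|x)$. For a quantum channel (CPTP map) $\mathcal{N}$, $\mathrm{cv}(\mathcal{N})$ is the supremum, over all $n,n'\in\mathbb{N}$, all density operators $\rho_1,\dots,\rho_n$ on the input space and all POVMs $\{\Pi_y\}_{y=1}^{n'}$ on the output space, of $\mathrm{cv}(\mathbf{P})$ with $P(y|x)=\mathrm{Tr}[\Pi_y\mathcal{N}(\rho_x)]$. *)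

(* Defs.v *)
From HB Require Import structures.
From mathcomp Require Import all_boot all_order all_algebra.
From mathcomp Require Import all_classical all_reals all_analysis.
From mathcomp.real_closed Require Import complex mxtens.

Set Implicit Arguments.
Unset Strict Implicit.
Unset Printing Implicit Defensive.

Import Order.TTheory GRing.Theory Num.Theory.
Import numFieldNormedType.Exports.

Local Open Scope classical_set_scope.
Local Open Scope ring_scope.
Local Open Scope sesquilinear_scope.

Section QuantumChannels.
Variable R : realType.
Local Notation C := R[i].

(* The order on R[i] makes [0 <= z] mean that z is real and nonnegative, so
   this includes hermitianness. *)
Definition psdmx d (A : 'M[C]_d) : Prop :=
  forall v : 'cV[C]_d, 0 <= (v ^t* *m A *m v) 0 0.

Definition density d (rho : 'M[C]_d) : Prop := psdmx rho /\ \tr rho = 1.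

Definition povm d m (Pi : 'I_m -> 'M[C]_d) : Prop :=
  (forall y, psdmx (Pi y)) /\ \sum_y Pi y = 1%:M.

(* [P x y] is the transition probability P(y|x); the unit 0 of the iterated
   maximum is harmless since probabilities are nonnegative and n > 0. *)
Definition classical_cv n m (P : 'I_n -> 'I_m -> R) : R :=
  \sum_(y < m) \big[Num.max/0]_(x < n) P x y.

Definition transition d e n m (N : 'M[C]_d -> 'M[C]_e)
    (rho : 'I_n -> 'M[C]_d) (Pi : 'I_m -> 'M[C]_e) (x : 'I_n) (y : 'I_m) : R :=
  complex.Re (\tr (Pi y *m N (rho x))).

Definition cv_values d e (N : 'M[C]_d -> 'M[C]_e) : set R :=
  [set c | exists (n m : nat) (rho : 'I_n -> 'M[C]_d) (Pi : 'I_m -> 'M[C]_e),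
    [/\ (0 < n)%N, (0 < m)%N, forall x, density (rho x), povm Pi &
        c = classical_cv (transition N rho Pi)]].

(* For a channel N with d, e > 0, [cv_values N] is nonempty and bounded above
   by e: the maximum over x of Tr[Pi_y N(rho_x)] is at most Tr[Pi_y]. *)
Definition cv d e (N : 'M[C]_d -> 'M[C]_e) : R := sup (cv_values N).

(* [N] tensor [M]: with X = \sum_(i, j) E_ij *t X_ij decomposed into blocks,
   X is sent to \sum_(i, j) N(E_ij) *t M(X_ij). *)
Definition tens_map d1 e1 d2 e2
    (N : {linear 'M[C]_d1 -> 'M[C]_e1}) (M : {linear 'M[C]_d2 -> 'M[C]_e2})
    (X : 'M[C]_(d1 * d2)) : 'M[C]_(e1 * e2) :=
  \sum_(i < d1) \sum_(j < d1)
    tensmx (N (delta_mx i j))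
           (M (\matrix_(k < d2, l < d2)
                 X (mxtens_index (i, k)) (mxtens_index (j, l)))).

Lemma tens_map_is_linear d1 e1 d2 e2
    (N : {linear 'M[C]_d1 -> 'M[C]_e1}) (M : {linear 'M[C]_d2 -> 'M[C]_e2}) :
  linear (tens_map N M).
Proof.
move=> a X Y; rewrite /tens_map scaler_sumr -big_split; apply: eq_bigr => i _.
rewrite scaler_sumr -big_split; apply: eq_bigr => j _ /=.
set B := fun Z : 'M[C]_(d1 * d2) => \matrix_(k < d2, l < d2)
  Z (mxtens_index (i, k)) (mxtens_index (j, l)).
have -> : \matrix_(k, l) (a *: X + Y) (mxtens_index (i, k))
    (mxtens_index (j, l)) = a *: B X + B Y.
  by apply/matrixP => k l; rewrite !mxE.
rewrite linearP; apply/matrixP => k l; rewrite !mxE mulrDr.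
by rewrite mulrCA.
Qed.

HB.instance Definition _ d1 e1 d2 e2
    (N : {linear 'M[C]_d1 -> 'M[C]_e1}) (M : {linear 'M[C]_d2 -> 'M[C]_e2}) :=
  GRing.isLinear.Build C 'M[C]_(d1 * d2) 'M[C]_(e1 * e2) _ (tens_map N M)
    (tens_map_is_linear N M).

Lemma tens_mapE d1 e1 d2 e2
    (N : {linear 'M[C]_d1 -> 'M[C]_e1}) (M : {linear 'M[C]_d2 -> 'M[C]_e2})
    (A : 'M[C]_d1) (B : 'M[C]_d2) :
  tens_map N M (tensmx A B) = tensmx (N A) (M B).
Proof.
rewrite [in RHS](matrix_sum_delta A) linear_sum.
apply/matrixP => k l; rewrite /tens_map !mxE !summxE mulr_suml.
apply: eq_bigr => i _; rewrite linear_sum !summxE mulr_suml.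
apply: eq_bigr => j _; rewrite linearZ !mxE /=.
have -> : \matrix_(k0, l0) tensmx A B (mxtens_index (i, k0))
    (mxtens_index (j, l0)) = A i j *: B.
  by apply/matrixP => k0 l0; rewrite !mxE !mxtens_indexK.
by rewrite linearZ !mxE /= mulrCA mulrA.
Qed.

(* [d ^ k], but with [pow_dim d k.+1] convertible to [d * pow_dim d k]. *)
Definition pow_dim (d k : nat) : nat := iter k (muln d) 1%N.

Fixpoint tens_pow d e (N : {linear 'M[C]_d -> 'M[C]_e}) (k : nat) :
    {linear 'M[C]_(pow_dim d k) -> 'M[C]_(pow_dim e k)} :=
  match k with
  | 0 => (idfun : {linear 'M[C]_1 -> 'M[C]_1})
  | k'.+1 => tens_map N (tens_pow N k')
  end.

Definition log2 (x : R) : R := ln x / ln 2.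

Definition cv_rate d e (N : {linear 'M[C]_d -> 'M[C]_e}) (k : nat) : R :=
  k%:R^-1 * log2 (cv (tens_pow N k)).

Definition cv_capacity d e (N : {linear 'M[C]_d -> 'M[C]_e}) : R :=
  lim (cv_rate N @ \oo).

Definition mx2 (a b c d : C) : 'M[C]_2 :=
  \matrix_(i < 2, j < 2) nth 0 (nth [::] [:: [:: a; b]; [:: c; d]] i) j.

Definition sigma_x : 'M[C]_2 := mx2 0 1 1 0.
Definition sigma_y : 'M[C]_2 := mx2 0 (- 'i%C) 'i%C 0.
Definition sigma_z : 'M[C]_2 := mx2 1 0 0 (- 1).

Definition pauli_channel (p0 p1 p2 p3 : R) (rho : 'M[C]_2) : 'M[C]_2 :=
  p0%:C%C *: rho + p1%:C%C *: (sigma_x *m rho *m sigma_x)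
  + p2%:C%C *: (sigma_z *m rho *m sigma_z)
  + p3%:C%C *: (sigma_y *m rho *m sigma_y).

Lemma pauli_channel_is_linear p0 p1 p2 p3 :
  linear (pauli_channel p0 p1 p2 p3).
Proof.
move=> a X Y; rewrite /pauli_channel.
have conjP (S : 'M[C]_2) : S *m (a *: X + Y) *m S =
    a *: (S *m X *m S) + S *m Y *m S.
  by rewrite mulmxDr mulmxDl -scalemxAr -scalemxAl.
rewrite !conjP !scalerDr !scalerA ![_ * a]mulrC.
by rewrite [RHS]addrACA; congr (_ + _); rewrite [RHS]addrACA; congr (_ + _);
  rewrite [RHS]addrACA.
Qed.

HB.instance Definition _ p0 p1 p2 p3 :=
  GRing.isLinear.Build C 'M[C]_2 'M[C]_2 _ (pauli_channel p0 p1 p2 p3)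
    (pauli_channel_is_linear p0 p1 p2 p3).

End QuantumChannels.

(* Main.v *)
(* The tensor power satisfies cv(N^k) = (2 (q1 + q2))^k exactly.

   Upper bound: with p_a >= p_b >= p_c >= p_d, write
     N = (p_a - p_b) U_a + (p_b - p_c) (U_a + U_b)
         + (p_c - p_d) (U_a + U_b + U_c) + p_d (U_a + U_b + U_c + U_d),
   where the U_i are the Pauli conjugations.  The sum of all four maps rho to
   2 tr(rho) I, and omitting one of them leaves rho |-> tr(rho) I plus a unitary
   conjugate of the transpose.  So N is a positive combination, of total weight
   p_a + p_b = q1 + q2, of three kinds of maps: unitary conjugations, transposes
   and rho |-> tr(rho) I.  A tensor product of such maps sends a pure state, up to
   unitaries, to a partial transpose of one of its reduced states tensored with an
   identity; partial transposition preserves the Hilbert-Schmidt norm, so the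
   operator norm is at most 1.  Hence N^k(rho) <= (q1 + q2)^k I, and summing over a
   POVM gives the factor 2^k.

   Lower bound: product states of eigenvectors of the Pauli matrix proportional to the
   product of the two most likely ones, with a POVM made of the same projectors. *)
Require Import Defs.
From mathcomp Require Import all_boot all_order all_algebra.
From mathcomp Require Import all_classical all_reals all_analysis.
From mathcomp.real_closed Require Import complex mxtens.
From mathcomp Require Import ring lra.

Set Implicit Arguments.
Unset Strict Implicit.
Unset Printing Implicit Defensive.

Import Order.TTheory GRing.Theory Num.Theory.
Import numFieldNormedType.Exports.
Local Open Scope classical_set_scope.
Local Open Scope ring_scope.
Local Open Scope sesquilinear_scope.

(** * Norm bounds stable under ancillas, and their one-dimensional base case *)

Section StableBound.
Variable R : realType.
Local Notation C := R[i].

(** Once the norms are inside the sums, twice the difference of the two sides is the double sum of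
    the squares $(|x_i||y_j|-|x_j||y_i|)^2$. *)
Lemma cauchy_schwarz_sum (I : finType) (x y : I -> C) :
  `|\sum_i x i * y i| ^+ 2 <= (\sum_i `|x i| ^+ 2) * (\sum_i `|y i| ^+ 2).
Proof.
have le1 : `|\sum_i x i * y i| ^+ 2 <= (\sum_i `|x i| * `|y i|) ^+ 2.
  have ge0 : 0 <= \sum_i `|x i| * `|y i| by apply: sumr_ge0 => i _; rewrite mulr_ge0.
  apply: lerXn2r; rewrite ?nnegrE//.
  by apply: le_trans (ler_norm_sum _ _ _) _; apply: ler_sum => i _; rewrite normrM.
apply: (le_trans le1); rewrite expr2 -(ler_pM2r (ltr0n C 2)).
set A := (X in X * _ <= _); set B := (X in _ <= X * _).
have -> : A * 2%:R = \sum_i \sum_j (`|x i| * `|y i|) * (`|x j| * `|y j|) * 2%:R.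
  rewrite /A big_distrl /= big_distrl; apply: eq_bigr => i _.
  by rewrite big_distrr /= big_distrl.
have -> : B * 2%:R = \sum_i \sum_j (`|x i| ^+ 2 * `|y j| ^+ 2 +
    `|x j| ^+ 2 * `|y i| ^+ 2).
  under eq_bigr do rewrite big_split; rewrite big_split mulr_natr mulr2n /=.
  congr (_ + _); last rewrite exchange_big /=;
    by rewrite /B big_distrl; apply: eq_bigr => i _; rewrite big_distrr.
apply: ler_sum => i _; apply: ler_sum => j _.
rewrite -subr_ge0; set a := `|x i|; set b := `|y j|; set c := `|x j|; set d := `|y i|.
have -> : a ^+ 2 * b ^+ 2 + c ^+ 2 * d ^+ 2 - a * d * (c * b) * 2%:R
   = (a * b - c * d) ^+ 2 by ring.
by apply: real_exprn_even_ge0 => //; rewrite rpredB// rpredM// normr_real.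
Qed.

Definition sqnorm d (v : 'cV[C]_d) : C := \sum_i `|v i 0| ^+ 2.

Lemma sqnorm_ge0 d (v : 'cV[C]_d) : 0 <= sqnorm v.
Proof. by apply: sumr_ge0 => i _; rewrite exprn_ge0. Qed.

Definition sandwich d (f : 'cV[C]_d) (A : 'M[C]_d) (g : 'cV[C]_d) : C :=
  (f ^t* *m A *m g) 0 0.

Lemma sandwichE d (f : 'cV[C]_d) (A : 'M[C]_d) (g : 'cV[C]_d) :
  sandwich f A g = \sum_k \sum_l (f k 0)^* * A k l * g l 0.
Proof.
rewrite /sandwich mxE exchange_big; apply: eq_bigr => l _.
by rewrite mxE big_distrl; apply: eq_bigr => k _; rewrite !mxE.
Qed.

Lemma sandwich_lincomb d (K : finType) (a b : K -> C) (f g : K -> 'cV[C]_d)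
    (A : 'M[C]_d) :
  sandwich (\sum_k a k *: f k) A (\sum_l b l *: g l) =
  \sum_k \sum_l (a k)^* * b l * sandwich (f k) A (g l).
Proof.
rewrite /sandwich; have -> : (\sum_k a k *: f k) ^t* = \sum_k (a k)^* *: (f k) ^t*.
  apply/matrixP => i j; rewrite !mxE !summxE rmorph_sum.
  by apply: eq_bigr => k _; rewrite !mxE rmorphM.
rewrite !mulmx_suml summxE; apply: eq_bigr => k _.
rewrite mulmx_sumr summxE; apply: eq_bigr => l _.
by rewrite -scalemxAl -scalemxAr -scalemxAl !mxE mulrCA mulrA.
Qed.

(* The sum is the sandwich of (id (x) transpose (x) L) applied to the rank-one
   operator of [psi], the identity acting on C^I and the transpose on C^J. *)
Definition stable_form d e (L : 'M[C]_d -> 'M[C]_e) (I J : finType)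
    (psi : I -> J -> 'cV[C]_d) (phi : I -> J -> 'cV[C]_e) : C :=
  \sum_(p : (I * I) * (J * J))
    sandwich (phi p.1.1 p.2.1) (L (psi p.1.1 p.2.2 *m (psi p.1.2 p.2.1) ^t*))
             (phi p.1.2 p.2.2).

Definition sqnorm_fam d (I J : finType) (psi : I -> J -> 'cV[C]_d) : C :=
  \sum_(q : I * J) sqnorm (psi q.1 q.2).

(** All finite ancillas are allowed so that the induction on the tensor power closes: the index of a
    factor under unitary conjugation is absorbed into [I], under a transpose into [J]. *)
Definition stable_bound d e (L : 'M[C]_d -> 'M[C]_e) (c : C) : Prop :=
  forall (I J : finType) (psi : I -> J -> 'cV[C]_d) (phi : I -> J -> 'cV[C]_e),
    `|stable_form L psi phi| <= c * (sqnorm_fam psi * sqnorm_fam phi).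

(** Here [psi] and [phi] are matrices and the form is $\sum_{a,b}G_{ab}\overline{G_{ba}}$ with
    $G=\phi^\dagger\psi$. It is at most the squared Hilbert-Schmidt norm of $G$, itself bounded by
    Cauchy-Schwarz. *)
Lemma stable_bound_id1 : stable_bound (idfun : 'M[C]_1 -> 'M[C]_1) 1.
Proof.
move=> I J psi phi; rewrite mul1r.
pose x i a := phi i a 0 0; pose y i a := psi i a 0 0.
pose G a b := \sum_i (x i a)^* * y i b.
have nE (z : I -> J -> 'cV[C]_1) :
    sqnorm_fam z = \sum_a \sum_i `|z i a 0 0| ^+ 2.
  rewrite exchange_big /= pair_bigA; apply: eq_bigr => q _ /=.
  by rewrite /sqnorm big_ord1.
have -> : stable_form idfun psi phi = \sum_(q : J * J) G q.1 q.2 * (G q.2 q.1)^*.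
  rewrite /stable_form.
  rewrite -(pair_bigA _ (fun (ij : I * I) (ab : J * J) =>
     sandwich (phi ij.1 ab.1) (psi ij.1 ab.2 *m (psi ij.2 ab.1) ^t*)
             (phi ij.2 ab.2))) exchange_big /=.
  apply: eq_bigr => -[a b] _ /=.
  rewrite /G rmorph_sum big_distrlr /= pair_bigA /=; apply: eq_bigr => -[i j] _ /=.
  rewrite sandwichE !big_ord1 !mxE big_ord1 !mxE rmorphM /= conjCK /x /y.
  by rewrite !ord1; ring.
apply: (le_trans (ler_norm_sum _ _ _)).
have G2 : \sum_(q : J * J) `|G q.1 q.2| ^+ 2 <= sqnorm_fam psi * sqnorm_fam phi.
  rewrite mulrC !nE big_distrlr /= pair_bigA /=; apply: ler_sum => -[a b] _ /=.
  apply: le_trans (cauchy_schwarz_sum _ _) _.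
  by rewrite (eq_bigr (fun i => `|x i a| ^+ 2)) // => i _; rewrite norm_conjC.
apply: le_trans G2.
have sym : \sum_(q : J * J) `|G q.1 q.2| ^+ 2 = \sum_(q : J * J) `|G q.2 q.1| ^+ 2.
  rewrite -(pair_bigA _ (fun a b => `|G a b| ^+ 2)) exchange_big /=.
  by rewrite pair_bigA.
rewrite -(ler_pM2r (ltr0n C 2)) [leRHS]mulr_natr [leRHS]mulr2n {2}sym.
rewrite big_distrl -big_split /=; apply: ler_sum => q _.
rewrite normrM norm_conjC -subr_ge0.
set a := `|_|; set b := `|_|.
have -> : a ^+ 2 + b ^+ 2 - a * b * 2%:R = (a - b) ^+ 2 by ring.
by apply: real_exprn_even_ge0 => //; rewrite rpredB// normr_real.
Qed.

End StableBound.

(** * Peeling off the first tensor factor *)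

Section CrossForm.
Variable R : realType.
Local Notation C := R[i].

Lemma sqnorm_unitary_mix n d (U : 'M[C]_n) (v : 'I_n -> 'cV[C]_d) :
  U *m U ^t* = 1%:M ->
  \sum_x sqnorm (\sum_k (U k x)^* *: v k) = \sum_k sqnorm (v k).
Proof.
move=> UU; rewrite /sqnorm exchange_big [RHS]exchange_big; apply: eq_bigr => r _.
have UUE k k' : \sum_x (U k x)^* * U k' x = (k == k')%:R.
  have := congr1 (fun A : 'M[C]_n => A k' k) UU; rewrite !mxE eq_sym => <-.
  by apply: eq_bigr => x _; rewrite !mxE mulrC.
transitivity (\sum_x \sum_(k : 'I_n) \sum_(k' : 'I_n)
   ((U k x)^* * U k' x) * (v k r 0 * (v k' r 0)^*)).
  apply: eq_bigr => x _; rewrite normCK summxE rmorph_sum big_distrlr /=.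
  apply: eq_bigr => k _; apply: eq_bigr => k' _.
  by rewrite !mxE rmorphM /= conjCK; ring.
rewrite exchange_big; apply: eq_bigr => k _; rewrite exchange_big /=.
rewrite (bigD1 k) //= [X in _ + X]big1 ?addr0 => [|k' kk'].
  by rewrite -big_distrl /= UUE eqxx mul1r normCK.
by rewrite -big_distrl /= UUE eq_sym (negbTE kk') mul0r.
Qed.

(** The first pair in [q] holds the row and column of the input block on the first factor, the
    second pair those of the output block. Weighting by the entries of [N (delta_mx x y)] gives the
    stable form of $N\otimes L$. *)
Definition cross_form d e n (L : 'M[C]_d -> 'M[C]_e) (I J : finType)
    (psi : 'I_n -> I -> J -> 'cV[C]_d) (phi : 'I_n -> I -> J -> 'cV[C]_e)
    (q : ('I_n * 'I_n) * ('I_n * 'I_n)) : C :=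
  \sum_(p : (I * I) * (J * J))
    sandwich (phi q.2.1 p.1.1 p.2.1)
             (L (psi q.1.1 p.1.1 p.2.2 *m (psi q.1.2 p.1.2 p.2.1) ^t*))
             (phi q.2.2 p.1.2 p.2.2).

Section Bounds.
Variables (d e n : nat) (L : 'M[C]_d -> 'M[C]_e) (c : C).
Hypothesis Lc : stable_bound L c.
Variables (I J : finType) (psi : 'I_n -> I -> J -> 'cV[C]_d).
Variable (phi : 'I_n -> I -> J -> 'cV[C]_e).

Let bound := c * ((\sum_x sqnorm_fam (psi x)) * (\sum_k sqnorm_fam (phi k))).

(** The weights are the kernel of $\rho\mapsto U\rho U^\dagger$. The block index of [psi] joins [I],
    and [U] moves onto [phi], whose total squared norm is unchanged. *)
Lemma cross_form_conj (U : 'M[C]_n) : U *m U ^t* = 1%:M ->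
  `|\sum_q U q.2.1 q.1.1 * (U q.2.2 q.1.2)^* * cross_form L psi phi q| <= bound.
Proof.
move=> UU; rewrite /bound.
pose psi' (ix : I * 'I_n) a := psi ix.2 ix.1 a.
pose phi' (ix : I * 'I_n) a := \sum_k (U k ix.2)^* *: phi k ix.1 a.
have -> : \sum_x sqnorm_fam (psi x) = sqnorm_fam psi'.
  rewrite /sqnorm_fam pair_bigA /=.
  rewrite (reindex (fun s : (I * 'I_n) * J => (s.1.2, (s.1.1, s.2)))) //.
  by exists (fun s : 'I_n * (I * J) => ((s.2.1, s.1), s.2.2)) => [[[? ?] ?]|[? [? ?]]].
have -> : \sum_k sqnorm_fam (phi k) = sqnorm_fam phi'.
  rewrite /sqnorm_fam exchange_big /=.
  under eq_bigr => q _ do rewrite -(sqnorm_unitary_mix (fun k => phi k q.1 q.2) UU).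
  rewrite pair_bigA /=.
  rewrite (reindex (fun s : (I * 'I_n) * J => ((s.1.1, s.2), s.1.2))) //.
  by exists (fun s : (I * J) * 'I_n => ((s.1.1, s.2), s.1.2)) => [[[? ?] ?]|[[? ?] ?]].
suff -> : \sum_q U q.2.1 q.1.1 * (U q.2.2 q.1.2)^* * cross_form L psi phi q =
  stable_form L psi' phi' by exact: Lc.
rewrite /stable_form /cross_form.
under eq_bigr do rewrite big_distrr; rewrite pair_bigA /=.
under [RHS]eq_bigr do rewrite sandwich_lincomb pair_bigA; rewrite pair_bigA /=.
rewrite (reindex (fun s : (((I * 'I_n) * (I * 'I_n)) * (J * J)) * ('I_n * 'I_n) =>
   (((s.1.1.1.2, s.1.1.2.2), s.2), ((s.1.1.1.1, s.1.1.2.1), s.1.2)))) /=.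
  by apply: eq_bigr => s _; rewrite conjCK.
exists (fun s => ((((s.2.1.1, s.1.1.1), (s.2.1.2, s.1.1.2)), s.2.2), s.1.2)).
  by move=> [[[[? ?] [? ?]] [? ?]] [? ?]].
by move=> [[[? ?] [? ?]] [[? ?] [? ?]]].
Qed.

(** The weights are the kernel of $\rho\mapsto U\rho^TU^\dagger$: row and column are swapped as on
    the transposed ancilla, so the block index now joins [J]. *)
Lemma cross_form_transpose (U : 'M[C]_n) : U *m U ^t* = 1%:M ->
  `|\sum_q U q.2.1 q.1.2 * (U q.2.2 q.1.1)^* * cross_form L psi phi q| <= bound.
Proof.
move=> UU; rewrite /bound.
pose psi' i (ax : J * 'I_n) := psi ax.2 i ax.1.
pose phi' i (ax : J * 'I_n) := \sum_k (U k ax.2)^* *: phi k i ax.1.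
have -> : \sum_x sqnorm_fam (psi x) = sqnorm_fam psi'.
  rewrite /sqnorm_fam pair_bigA /=.
  rewrite (reindex (fun s : I * (J * 'I_n) => (s.2.2, (s.1, s.2.1)))) //.
  by exists (fun s : 'I_n * (I * J) => (s.2.1, (s.2.2, s.1))) => [[? [? ?]]|[? [? ?]]].
have -> : \sum_k sqnorm_fam (phi k) = sqnorm_fam phi'.
  rewrite /sqnorm_fam exchange_big /=.
  under eq_bigr => q _ do rewrite -(sqnorm_unitary_mix (fun k => phi k q.1 q.2) UU).
  rewrite pair_bigA /=.
  rewrite (reindex (fun s : I * (J * 'I_n) => ((s.1, s.2.1), s.2.2))) //.
  by exists (fun s : (I * J) * 'I_n => (s.1.1, (s.1.2, s.2))) => [[? [? ?]]|[[? ?] ?]].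
suff -> : \sum_q U q.2.1 q.1.2 * (U q.2.2 q.1.1)^* * cross_form L psi phi q =
  stable_form L psi' phi' by exact: Lc.
rewrite /stable_form /cross_form.
under eq_bigr do rewrite big_distrr; rewrite pair_bigA /=.
under [RHS]eq_bigr do rewrite sandwich_lincomb pair_bigA; rewrite pair_bigA /=.
rewrite (reindex (fun s : ((I * I) * ((J * 'I_n) * (J * 'I_n))) * ('I_n * 'I_n) =>
   (((s.1.2.2.2, s.1.2.1.2), s.2), (s.1.1, (s.1.2.1.1, s.1.2.2.1))))) /=.
  by apply: eq_bigr => s _; rewrite conjCK.
exists (fun s => ((s.2.1, ((s.2.2.1, s.1.1.2), (s.2.2.2, s.1.1.1))), s.1.2)).
  by move=> [[[? ?] [[? ?] [? ?]]] [? ?]].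
by move=> [[[? ?] [? ?]] [[? ?] [? ?]]].
Qed.

(** The weights are the kernel of $\rho\mapsto\mathrm{tr}(\rho)I$. The sum splits into one stable
    form for each input block and output block, and so does the product of the total norms. *)
Lemma cross_form_trace :
  `|\sum_q (q.1.1 == q.1.2)%:R * (q.2.1 == q.2.2)%:R * cross_form L psi phi q|
    <= bound.
Proof.
have -> : \sum_q (q.1.1 == q.1.2)%:R * (q.2.1 == q.2.2)%:R *
      cross_form L psi phi q = \sum_x \sum_k stable_form L (psi x) (phi k).
  rewrite -(pair_bigA _ (fun (s t : 'I_n * 'I_n) => (s.1 == s.2)%:R *
    (t.1 == t.2)%:R * cross_form L psi phi (s, t))) /=.
  rewrite -(pair_bigA _ (fun (x y : 'I_n) => \sum_(t : 'I_n * 'I_n) (x == y)%:R *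
    (t.1 == t.2)%:R * cross_form L psi phi ((x, y), t))) /=.
  apply: eq_bigr => x _; rewrite (bigD1 x) //= [X in _ + X]big1 ?addr0; last first.
    move=> y yx; rewrite big1 // => t _.
    by rewrite eq_sym (negbTE yx) !mul0r.
  rewrite -(pair_bigA _ (fun (k l : 'I_n) => (x == x)%:R *
    (k == l)%:R * cross_form L psi phi ((x, x), (k, l)))) /=.
  apply: eq_bigr => k _; rewrite (bigD1 k) //= [X in _ + X]big1 ?addr0; last first.
    by move=> l lk; rewrite eq_sym (negbTE lk) mulr0 mul0r.
  by rewrite !eqxx !mul1r.
rewrite /bound big_distrlr /= big_distrr.
apply: le_trans (ler_norm_sum _ _ _) _; apply: ler_sum => x _.
rewrite big_distrr; apply: le_trans (ler_norm_sum _ _ _) _.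
by apply: ler_sum => k _; exact: Lc.
Qed.

End Bounds.

Definition block n d (v : 'cV[C]_(n * d)) (k : 'I_n) : 'cV[C]_d :=
  \col_l v (mxtens_index (k, l)) 0.

Lemma sum_mxtens (V : nmodType) (m n : nat) (F : 'I_(m * n) -> V) :
  \sum_i F i = \sum_k \sum_l F (mxtens_index (k, l)).
Proof.
rewrite pair_bigA /= (reindex (@mxtens_index m n)) /=.
  by apply: eq_bigr => -[].
by exists (@mxtens_unindex m n) => ? _; rewrite (mxtens_indexK, mxtens_unindexK).
Qed.

Lemma sqnorm_block n d (v : 'cV[C]_(n * d)) :
  \sum_k sqnorm (block v k) = sqnorm v.
Proof.
rewrite /sqnorm sum_mxtens; apply: eq_bigr => k _.
by apply: eq_bigr => l _; rewrite mxE.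
Qed.

Lemma sandwich_tens n e (A : 'M[C]_n) (B : 'M[C]_e) (f g : 'cV[C]_(n * e)) :
  sandwich f (tensmx A B) g =
  \sum_k \sum_l A k l * sandwich (block f k) B (block g l).
Proof.
rewrite sandwichE sum_mxtens; apply: eq_bigr => k _.
under eq_bigr do rewrite sum_mxtens; rewrite exchange_big; apply: eq_bigr => l _.
rewrite sandwichE big_distrr; apply: eq_bigr => r _.
rewrite big_distrr; apply: eq_bigr => s _.
by rewrite tensmxE !mxE /=; ring.
Qed.

Lemma sandwich_tens_map n d e (N : {linear 'M[C]_n -> 'M[C]_n})
    (M : {linear 'M[C]_d -> 'M[C]_e}) (f g : 'cV[C]_(n * e)) (v w : 'cV[C]_(n * d)) :
  sandwich f (tens_map N M (v *m w ^t*)) g =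
  \sum_(q : ('I_n * 'I_n) * ('I_n * 'I_n)) N (delta_mx q.1.1 q.1.2) q.2.1 q.2.2 *
    sandwich (block f q.2.1) (M (block v q.1.1 *m (block w q.1.2) ^t*))
             (block g q.2.2).
Proof.
rewrite -(pair_bigA _ (fun (s t : 'I_n * 'I_n) => N (delta_mx s.1 s.2) t.1 t.2 *
    sandwich (block f t.1) (M (block v s.1 *m (block w s.2) ^t*)) (block g t.2))) /=.
have -> : tens_map N M (v *m w ^t*) = \sum_(s : 'I_n * 'I_n)
    tensmx (N (delta_mx s.1 s.2)) (M (block v s.1 *m (block w s.2) ^t*)).
  rewrite /tens_map pair_bigA; apply: eq_bigr => s _ /=.
  congr (tensmx _ _); congr (M _).
  by apply/matrixP => k l; rewrite !mxE; apply: eq_bigr => o _; rewrite !mxE !ord1.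
rewrite {1}/sandwich mulmx_sumr mulmx_suml summxE; apply: eq_bigr => t _.
by rewrite -/(sandwich _ _ _) sandwich_tens pair_bigA.
Qed.

Lemma stable_form_tens_map n d e (N : {linear 'M[C]_n -> 'M[C]_n})
    (M : {linear 'M[C]_d -> 'M[C]_e}) (I J : finType)
    (psi : I -> J -> 'cV[C]_(n * d)) (phi : I -> J -> 'cV[C]_(n * e)) :
  stable_form (tens_map N M) psi phi =
  \sum_(q : ('I_n * 'I_n) * ('I_n * 'I_n)) N (delta_mx q.1.1 q.1.2) q.2.1 q.2.2 *
    cross_form M (fun k i a => block (psi i a) k) (fun k i a => block (phi i a) k) q.
Proof.
rewrite /stable_form; under eq_bigr do rewrite sandwich_tens_map.
by rewrite exchange_big /=; apply: eq_bigr => q _; rewrite -big_distrr.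
Qed.

Lemma sqnorm_fam_block n d (I J : finType) (psi : I -> J -> 'cV[C]_(n * d)) :
  \sum_k sqnorm_fam (fun i a => block (psi i a) k) = sqnorm_fam psi.
Proof.
by rewrite exchange_big /=; apply: eq_bigr => q _; rewrite sqnorm_block.
Qed.

End CrossForm.

(** * Pauli identities and the bound on tensor powers *)

Section Pauli.
Variable R : realType.
Local Notation C := R[i].

(** The order x, z, y is that of the channel weights. From index 4 on the value is the identity, so
    unitarity holds at every index. *)
Definition pauli (i : nat) : 'M[C]_2 :=
  nth 1%:M [:: 1%:M; sigma_x R; sigma_z R; sigma_y R] i.

Lemma conj_complexE (a b : R) : (a +i* b)%C^* = (a -i* b)%C. Proof. by []. Qed.

Lemma pauli_herm i : (pauli i) ^t* = pauli i.
Proof.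
apply/matrixP => k l; rewrite !mxE.
do 4?[case: i => [|i]]; rewrite /pauli /= ?nth_nil !mxE;
  case: k => [[|[|//]] ?]; case: l => [[|[|//]] ?] //=;
   apply/eqP; rewrite eq_complex /= ?oppr0 ?opprK ?eqxx //.
Qed.

Lemma pauli_unitary i : pauli i *m (pauli i) ^t* = 1%:M.
Proof.
rewrite pauli_herm; apply/matrixP => k l; rewrite !mxE !big_ord_recl big_ord0.
do 4?[case: i => [|i]]; rewrite /pauli /= ?nth_nil !mxE;
  case: k => [[|[|//]] ?]; case: l => [[|[|//]] ?] //=;
   apply/eqP; rewrite eq_complex /=; apply/andP; split; apply/eqP; ring.
Qed.

(** Kernel form of $\mathrm{tr}(\rho)I-\sigma_i\rho\sigma_i=U\rho^TU^\dagger$, which follows from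
    the qubit identity $\mathrm{tr}(\rho)I-\rho=\sigma_y\rho^T\sigma_y$. *)
Lemma pauli_transpose i (q : ('I_2 * 'I_2) * ('I_2 * 'I_2)) :
  let U := pauli i *m sigma_y R in
  (q.1.1 == q.1.2)%:R * (q.2.1 == q.2.2)%:R -
     pauli i q.2.1 q.1.1 * (pauli i q.2.2 q.1.2)^* =
  U q.2.1 q.1.2 * (U q.2.2 q.1.1)^*.
Proof.
case: q => -[x y] [k l] U /=; rewrite {}/U !mxE !big_ord_recl !big_ord0.
do 4?[case: i => [|i]]; rewrite /pauli /= ?nth_nil !mxE;
  case: k => [[|[|//]] ?]; case: l => [[|[|//]] ?] //=;
  case: x => [[|[|//]] ?]; case: y => [[|[|//]] ?] //=;
   apply/eqP; rewrite eq_complex /=; apply/andP; split; apply/eqP; ring.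
Qed.


(** Kernel form of $\sum_i\sigma_i\rho\sigma_i=2\,\mathrm{tr}(\rho)I$. *)
Lemma pauli_sum (q : ('I_2 * 'I_2) * ('I_2 * 'I_2)) :
  \sum_(i <- iota 0 4) pauli i q.2.1 q.1.1 * (pauli i q.2.2 q.1.2)^* =
  (q.1.1 == q.1.2)%:R * (q.2.1 == q.2.2)%:R * 2%:R.
Proof.
case: q => -[x y] [k l] /=; rewrite !big_cons big_nil /pauli /= !mxE.
case: k => [[|[|//]] ?]; case: l => [[|[|//]] ?] //=;
  case: x => [[|[|//]] ?]; case: y => [[|[|//]] ?] //=;
   apply/eqP; rewrite eq_complex /=; apply/andP; split; apply/eqP; ring.
Qed.

Lemma pauli_channelE (p0 p1 p2 p3 : R) (rho : 'M[C]_2) :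
  pauli_channel p0 p1 p2 p3 rho = \sum_(i <- iota 0 4)
    (nth 0 [:: p0; p1; p2; p3] i)%:C%C *: (pauli i *m rho *m (pauli i) ^t*).
Proof.
rewrite !big_cons big_nil !pauli_herm /pauli_channel /pauli /=.
by rewrite mul1mx mulmx1 addr0 !addrA.
Qed.

Lemma pauli_channel_delta (p0 p1 p2 p3 : R) x y k l :
  pauli_channel p0 p1 p2 p3 (delta_mx x y) k l = \sum_(i <- iota 0 4)
    (nth 0 [:: p0; p1; p2; p3] i)%:C%C * (pauli i k x * (pauli i l y)^*).
Proof.
rewrite pauli_channelE summxE; apply: eq_bigr => i _; rewrite !mxE; congr (_ * _).
rewrite (bigD1 y) //= big1 ?addr0 => [|z zy]; rewrite !mxE (bigD1 x) //= big1 ?addr0.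
- by rewrite !mxE !eqxx mulr1.
- by move=> t tx; rewrite !mxE (negbTE tx) mulr0.
- by rewrite !mxE (negbTE zy) andbF mulr0 mul0r.
- by move=> t tx; rewrite !mxE (negbTE tx) mulr0.
Qed.

(** Positions are sorted along with the values, so that each weight keeps its Pauli matrix even when
    weights coincide. *)
Lemma sorted_weightsP (p0 p1 p2 p3 : R) : exists a b c d : nat,
  let p := nth 0 [:: p0; p1; p2; p3] in
  [/\ perm_eq [:: a; b; c; d] (iota 0 4), p b <= p a, p c <= p b, p d <= p c &
      sort >=%R [:: p0; p1; p2; p3] = [:: p a; p b; p c; p d]].
Proof.
set s := [:: p0; p1; p2; p3].
have /(perm_iotaP 0)[Is Is_perm sE] : perm_eq (sort >=%R s) s by rewrite perm_sort.
have := sort_sorted (@ge_total _ R) s; rewrite sE.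
have := perm_size Is_perm.
case: Is Is_perm sE => [|a [|b [|c [|d []]]]] //= Is_perm sE _ /and4P[ab bc cd _].
by exists a, b, c, d.
Qed.

(* Layer-cake decomposition of the weights [p a >= p b >= p c >= p d]. *)
Lemma weighted_norm_le (p : nat -> R) (v : nat -> C) (t K : C) (a b c d : nat) :
  perm_eq [:: a; b; c; d] (iota 0 4) ->
  p b <= p a -> p c <= p b -> p d <= p c -> 0 <= p d ->
  \sum_(i <- iota 0 4) v i = t * 2%:R ->
  (forall i, `|v i| <= K) -> `|t| <= K -> (forall i, `|t - v i| <= K) ->
  `|\sum_(i <- iota 0 4) (p i)%:C%C * v i| <= (p a + p b)%:C%C * K.
Proof.
move=> perm ba cb dc d0 vt vK tK tvK.
have sumE F : \sum_(i <- iota 0 4) F i = F a + F b + F c + F d :> C.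
  by rewrite -(perm_big _ perm) /= !big_cons big_nil addr0 !addrA.
move: vt; rewrite !sumE => vt.
have -> : (p a)%:C%C * v a + (p b)%:C%C * v b + (p c)%:C%C * v c + (p d)%:C%C * v d
  = (p a - p b)%:C%C * v a + (p b - p c)%:C%C * (v a + v b)
    + (p c - p d)%:C%C * (t + (t - v d)) + (p d)%:C%C * (t + t).
  have -> : v d = t * 2%:R - (v a + v b + v c) by rewrite -vt; ring.
  by rewrite !rmorphB /=; ring.
(* The layers of two, three and four maps are each a sum of two terms of norm at most [K], so the
   coefficients telescope to [p a + p b]. *)
have -> : (p a + p b)%:C%C * K = (p a - p b)%:C%C * K + (p b - p c)%:C%C * (K + K)
    + (p c - p d)%:C%C * (K + K) + (p d)%:C%C * (K + K).
  by rewrite !rmorphB rmorphD /=; ring.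
have term (x : R) (z w : C) : 0 <= x -> `|z| <= w -> `|x%:C%C * z| <= x%:C%C * w.
  by move=> x0 zw; rewrite normrM ger0_norm ?ler0c // ler_wpM2l ?ler0c.
have two (y z : C) : `|y| <= K -> `|z| <= K -> `|y + z| <= K + K.
  by move=> yK zK; rewrite (le_trans (ler_normD _ _)) // lerD.
do 3?[apply: le_trans (ler_normD _ _) _; apply: lerD]; apply: term;
  rewrite ?subr_ge0 //; exact: two.
Qed.

Lemma stable_bound_pauli_step (p0 p1 p2 p3 : R) d e
    (M : {linear 'M[C]_d -> 'M[C]_e}) (s : R) (m : C) :
  0 <= p0 -> 0 <= p1 -> 0 <= p2 -> 0 <= p3 ->
  let q := sort >=%R [:: p0; p1; p2; p3] in
  stable_bound M m ->
  stable_bound (tens_map (pauli_channel p0 p1 p2 p3) M)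
    ((nth 0 q 0 + nth 0 q 1)%:C%C * m).
Proof.
move=> p0_ge0 p1_ge0 p2_ge0 p3_ge0 q Mm I J psi phi; rewrite /q {q}.
have [a [b [c [f /= [perm ba cb fc ->]]]]] := sorted_weightsP p0 p1 p2 p3.
set p := nth 0 _ in ba cb fc *.
have pf : 0 <= p f.
  have : f \in iota 0 4 by rewrite -(perm_mem perm) !inE eqxx !orbT.
  by rewrite !inE /p => /or4P[] /eqP->.
rewrite stable_form_tens_map.
set W := cross_form _ _ _.
pose K := m * (sqnorm_fam psi * sqnorm_fam phi).
(* [v i] and [t] are the stable forms in which the first factor is conjugation by [pauli i],
   respectively $\rho\mapsto\mathrm{tr}(\rho)I$. *)
pose v i := \sum_q pauli i q.2.1 q.1.1 * (pauli i q.2.2 q.1.2)^* * W q.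
pose t := \sum_q (q.1.1 == q.1.2)%:R * (q.2.1 == q.2.2)%:R * W q.
have -> : \sum_q pauli_channel p0 p1 p2 p3 (delta_mx q.1.1 q.1.2) q.2.1 q.2.2 * W q
    = \sum_(i <- iota 0 4) (p i)%:C%C * v i.
  under [RHS]eq_bigr do rewrite big_distrr; rewrite exchange_big /=.
  apply: eq_bigr => q _; rewrite pauli_channel_delta big_distrl; apply: eq_bigr => i _.
  by rewrite -/p !mulrA.
have bE : K = m * ((\sum_x sqnorm_fam (fun i a => block (psi i a) x)) *
     (\sum_x sqnorm_fam (fun i a => block (phi i a) x))).
  by rewrite !sqnorm_fam_block.
rewrite -mulrA; apply: (weighted_norm_le (t := t) perm) => //.
- rewrite /v exchange_big /= /t big_distrl; apply: eq_bigr => q _.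
  by rewrite -big_distrl /= pauli_sum mulrAC.
- by move=> i; rewrite -/K bE; apply: cross_form_conj => //; exact: pauli_unitary.
- by rewrite -/K bE; exact: cross_form_trace.
- move=> i; rewrite -/K bE /t /v -sumrB.
  rewrite (eq_bigr _ (fun q _ => esym (mulrBl _ _ _))).
  rewrite (eq_bigr _ (fun q _ => congr1 (fun z => z * _) (pauli_transpose i q))).
  apply: cross_form_transpose => //.
  (* Unitarity of [pauli i *m sigma_y]; index 3 stands for [sigma_y]. *)
  rewrite trmx_mul map_mxM mulmxA -(mulmxA (pauli i)).
  by rewrite (pauli_unitary 3) mulmx1 pauli_unitary.
Qed.

Lemma stable_bound_tens_pow (p0 p1 p2 p3 : R) k :
  0 <= p0 -> 0 <= p1 -> 0 <= p2 -> 0 <= p3 ->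
  let q := sort >=%R [:: p0; p1; p2; p3] in
  stable_bound (tens_pow (pauli_channel p0 p1 p2 p3) k)
    ((nth 0 q 0 + nth 0 q 1) ^+ k)%:C%C.
Proof.
move=> p0_ge0 p1_ge0 p2_ge0 p3_ge0 q; elim: k => [|k IHk].
  by rewrite expr0; exact: stable_bound_id1.
by rewrite exprS rmorphM; exact: stable_bound_pauli_step.
Qed.

End Pauli.

(** * Positive semidefinite matrices as Gram matrices *)

Section Gram.
Variable R : realType.
Local Notation C := R[i].

Lemma sandwich_delta d (A : 'M[C]_d) i j :
  sandwich (delta_mx i 0) A (delta_mx j 0) = A i j.
Proof.
by rewrite /sandwich trmx_delta map_delta_mx -rowE -colE !mxE.
Qed.

(** The form is real at $e_i+ce_j$, hence $cA_{ij}+\bar cA_{ji}$ is real for every $c$; taking for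
    $c$ the values 1 and the imaginary unit suffices. *)
Lemma psdmx_herm d (A : 'M[C]_d) : psdmx A -> A ^t* = A.
Proof.
move=> psdA; apply/matrixP => j i; rewrite !mxE.
have real c : sandwich (\sum_(b : bool) (if b then 1 else c) *:
    delta_mx (if b then i else j) 0) A (\sum_(b : bool) (if b then 1 else c) *:
    delta_mx (if b then i else j) 0) \is Num.real by exact/ger0_real/psdA.
have diag k : A k k \is Num.real.
  by rewrite -sandwich_delta; exact/ger0_real/psdA.
have {}real c : c * A i j + c^* * A j i \is Num.real.
  have dd : A i i + `|c| ^+ 2 * A j j \is Num.real.
    by rewrite rpredD // rpredM // ger0_real // exprn_ge0.
  have := rpredB (real c) dd; rewrite sandwich_lincomb !big_bool /= !sandwich_delta.
  move=> h; apply: (eq_ind _ (fun z => z \is Num.real) h).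
  by rewrite conjC1 normCK; ring.
have := real 1; have := real 'i.
rewrite conjC1 conjCi !mul1r => /CrealP; rewrite rmorphD !rmorphM rmorphN /= conjCi.
rewrite opprK => h1 /CrealP; rewrite rmorphD /= => h2.
have {}h1 : (A i j)^* - (A j i)^* = A j i - A i j.
  apply: (mulfI (neq0Ci C)); rewrite !mulrBr.
  by move: h1; rewrite !mulNr => h1; rewrite -[RHS]opprB -h1; ring.
apply: (mulfI (_ : 2%:R != 0 :> C)); first by rewrite pnatr_eq0.
have -> : 2%:R * (A i j)^* = ((A i j)^* + (A j i)^*) + ((A i j)^* - (A j i)^*) by ring.
by rewrite h1 h2; ring.
Qed.

(** In a spectral decomposition the eigenvalues are values of the form at eigenvectors, so they have
    square roots to build [B] from. *)
Lemma psdmx_gram d (A : 'M[C]_d) : psdmx A -> exists B : 'M[C]_d, A = B *m B ^t*.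
Proof.
move=> psdA; have Ah := psdmx_herm psdA.
have /orthomx_spectralP : A \is normalmx by apply/normalmxP; rewrite Ah.
set P := spectralmx A; set s := spectral_diag A => AE.
have PU : P \is unitarymx := spectral_unitarymx A.
have PP : P *m P ^t* = 1%:M by exact/unitarymxP.
rewrite (invmx_unitary PU) in AE.
have s_ge0 i : 0 <= s 0 i.
  suff -> : s 0 i = sandwich (P ^t* *m delta_mx i 0) A (P ^t* *m delta_mx i 0).
    exact: psdA.
  have -> : sandwich (P ^t* *m delta_mx i 0) A (P ^t* *m delta_mx i 0) =
      sandwich (delta_mx i 0) (P *m A *m P ^t*) (delta_mx i 0).
    by rewrite /sandwich trmx_mul map_mxM trmxCK !mulmxA.
  rewrite sandwich_delta AE !mulmxA PP mul1mx -mulmxA PP mulmx1.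
  by rewrite mxE eqxx mulr1n.
exists (P ^t* *m diag_mx (\row_i sqrtC (s 0 i))).
rewrite trmx_mul map_mxM trmxCK mulmxA -(mulmxA (P ^t*)).
rewrite {1}AE; congr (_ *m _ *m _).
rewrite tr_diag_mx map_diag_mx mulmx_diag; congr diag_mx; apply/rowP => i.
by rewrite !mxE /= conj_Creal ?ger0_real ?sqrtC_ge0 // -expr2 sqrtCK.
Qed.

Lemma mxtrace_gram_mul d (B X : 'M[C]_d) :
  \tr (B *m B ^t* *m X) = \sum_i sandwich (col i B) X (col i B).
Proof.
rewrite -mulmxA mxtrace_mulC /mxtrace; apply: eq_bigr => i _.
rewrite /sandwich !mxE; apply: eq_bigr => k _; rewrite !mxE; congr (_ * _).
by apply: eq_bigr => l _; rewrite !mxE.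
Qed.

Lemma mxtrace_gram d (B : 'M[C]_d) :
  \tr (B *m B ^t*) = \sum_i sqnorm (col i B).
Proof.
rewrite /sqnorm exchange_big; apply: eq_bigr => k _; rewrite mxE.
by apply: eq_bigr => i _; rewrite !mxE normCK.
Qed.

Lemma gram_sum_col d (B : 'M[C]_d) :
  B *m B ^t* = \sum_i col i B *m (col i B) ^t*.
Proof.
apply/matrixP => k l; rewrite summxE !mxE; apply: eq_bigr => i _.
by rewrite !mxE big_ord1 !mxE.
Qed.

(** With one-point ancillas the hypothesis bounds $\langle g,L(bb^\dagger)g\rangle$ by
    $c|b|^2|g|^2$; this is summed over the columns of Gram factors of [A] and [D]. *)
Lemma stable_bound_mxtrace d e (L : {linear 'M[C]_d -> 'M[C]_e}) (c : C) A D :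
  stable_bound L c -> psdmx A -> psdmx D ->
  `|\tr (D *m L A)| <= c * (\tr A * \tr D).
Proof.
move=> Lc /psdmx_gram[B ->] /psdmx_gram[G ->].
rewrite mxtrace_gram_mul !mxtrace_gram [_ * (\sum_i _)]mulrC big_distrlr big_distrr.
apply: le_trans (ler_norm_sum _ _ _) _; apply: ler_sum => i _ /=.
rewrite big_distrr gram_sum_col linear_sum.
have -> : sandwich (col i G) (\sum_j L (col j B *m (col j B) ^t*)) (col i G) =
    \sum_j sandwich (col i G) (L (col j B *m (col j B) ^t*)) (col i G).
  by rewrite /sandwich mulmx_sumr mulmx_suml summxE.
apply: le_trans (ler_norm_sum _ _ _) _; apply: ler_sum => j _ /=.
have := Lc unit unit (fun _ _ => col j B) (fun _ _ => col i G).
rewrite /stable_form /sqnorm_fam !big_const !card_prod !card_unit /= !addr0.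
by rewrite [sqnorm (col j B) * _]mulrC.
Qed.

End Gram.

(** * Upper bound on the communication value, and product codes for the lower bound *)

Section CommunicationValue.
Variable R : realType.
Local Notation C := R[i].

(** Each outcome contributes at most $c\,\mathrm{tr}\,\Pi_y$, as states have trace one, and these
    traces add up to $e$. *)
Lemma stable_bound_cv_values d e (L : {linear 'M[C]_d -> 'M[C]_e}) (c : R) :
  0 <= c -> stable_bound L c%:C%C -> ubound (cv_values L) (c * e%:R).
Proof.
move=> c_ge0 Lc _ [n [m [rho [Pi [n_gt0 m_gt0 rhoP [Pi_psd Pi_sum] ->]]]]].
have PiE : \sum_y complex.Re (\tr (Pi y)) = e%:R.
  transitivity (complex.Re (\tr (\sum_y Pi y))).
    by rewrite [\tr _]raddf_sum raddf_sum.
  by rewrite Pi_sum mxtrace1 -(rmorph_nat (real_complex R)).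
rewrite -PiE big_distrr /classical_cv; apply: ler_sum => y _ /=.
have tr_ge0 : 0 <= \tr (Pi y).
  by apply: sumr_ge0 => i _; rewrite -sandwich_delta; exact: Pi_psd.
apply: bigmax_le => [|x _].
  (* This goal comes from the default 0 of the maximum. *)
  by rewrite mulr_ge0 //; move: tr_ge0; rewrite lecE => /andP[].
have [rho_psd rho1] := rhoP x.
have := stable_bound_mxtrace Lc rho_psd (Pi_psd y).
rewrite rho1 mul1r => /(le_trans (normc_ge_Re _)).
rewrite -(RRe_real (ger0_real tr_ge0)) -rmorphM lecR /= -/(transition _ _ _ _ _).
exact/le_trans/ler_norm.
Qed.

(* Gram factorizations of [n] states and of an [n]-outcome POVM: unlike bare
   positivity, they pass to tensor products. *)
Definition reaches d (N : 'M[C]_d -> 'M[C]_d) (c : C) : Prop :=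
  exists B G : 'I_d -> 'M[C]_d,
    [/\ forall y, \tr (B y *m (B y) ^t*) = 1,
        \sum_y G y *m (G y) ^t* = 1%:M &
        \sum_y \tr (G y *m (G y) ^t* *m N (B y *m (B y) ^t*)) = c].

Lemma gram_psdmx d (B : 'M[C]_d) : psdmx (B *m B ^t*).
Proof.
move=> v; rewrite mulmxA -mulmxA.
have -> : B ^t* *m v = (v ^t* *m B) ^t* by rewrite trmx_mul map_mxM trmxCK.
by rewrite mxE; apply: sumr_ge0 => i _; rewrite !mxE -normCK exprn_ge0.
Qed.

Lemma reaches_cv_values d (N : 'M[C]_d -> 'M[C]_d) (c : R) :
  (0 < d)%N -> reaches N c%:C%C -> exists2 v, cv_values N v & c <= v.
Proof.
move=> d_gt0 [B [G [B1 G1 BGc]]].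
pose rho x := B x *m (B x) ^t*; pose Pi y := G y *m (G y) ^t*.
exists (classical_cv (transition N rho Pi)).
  exists d, d, rho, Pi; split=> // [x|].
    by split; [exact: gram_psdmx | exact: B1].
  by split=> // y; exact: gram_psdmx.
(* The maximum over states is at least the diagonal term, where state and outcome agree. *)
rewrite -[leLHS]/(complex.Re c%:C%C) -BGc raddf_sum; apply: ler_sum => y _.
exact: (le_bigmax _ (fun x => transition N rho Pi x y)).
Qed.

Lemma trmxC_tens n d (A : 'M[C]_n) (B : 'M[C]_d) :
  (tensmx A B) ^t* = tensmx (A ^t*) (B ^t*).
Proof. by rewrite trmx_tens map_mxT. Qed.

Lemma gram_tens n d (A : 'M[C]_n) (B : 'M[C]_d) :
  tensmx A B *m (tensmx A B) ^t* = tensmx (A *m A ^t*) (B *m B ^t*).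
Proof. by rewrite trmxC_tens tensmx_mul. Qed.

Lemma mxtrace_tens n d (A : 'M[C]_n) (B : 'M[C]_d) :
  \tr (tensmx A B) = \tr A * \tr B.
Proof.
rewrite /mxtrace sum_mxtens big_distrlr; apply: eq_bigr => k _.
by apply: eq_bigr => l _; rewrite tensmxE.
Qed.

(** For product states and product measurement operators the trace factors, so the diagonal sums
    multiply. *)
Lemma reaches_tens_map n d (N : {linear 'M[C]_n -> 'M[C]_n})
    (M : {linear 'M[C]_d -> 'M[C]_d}) (a b : C) :
  reaches N a -> reaches M b -> reaches (tens_map N M) (a * b).
Proof.
move=> [B [G [B1 G1 BGa]]] [B' [G' [B1' G1' BGb]]].
exists (fun y => tensmx (B (mxtens_unindex y).1) (B' (mxtens_unindex y).2)).
exists (fun y => tensmx (G (mxtens_unindex y).1) (G' (mxtens_unindex y).2)).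
split=> [y||].
- by rewrite gram_tens mxtrace_tens B1 B1' mulr1.
- rewrite sum_mxtens; apply/matrixP => i j.
  case: (mxtens_indexP i) => i1 i2; case: (mxtens_indexP j) => j1 j2.
  under eq_bigr do under eq_bigr do rewrite mxtens_indexK gram_tens /=.
  transitivity ((1%:M : 'M[C]_n) i1 j1 * (1%:M : 'M[C]_d) i2 j2).
    rewrite -G1 -G1' !summxE big_distrlr; apply: eq_bigr => k _.
    by rewrite summxE; apply: eq_bigr => l _; rewrite tensmxE.
  rewrite !mxE -natrM mulnb; congr (_%:R : C).
  by rewrite (inj_eq (can_inj (@mxtens_indexK n d))).
- rewrite sum_mxtens -BGa -BGb big_distrlr; apply: eq_bigr => k _.
  apply: eq_bigr => l _.
  by rewrite mxtens_indexK !gram_tens tens_mapE tensmx_mul mxtrace_tens.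
Qed.

Lemma reaches_tens_pow d (N : {linear 'M[C]_d -> 'M[C]_d}) (a : C) k :
  reaches N a -> reaches (tens_pow N k) (a ^+ k).
Proof.
move=> Na; elim: k => [|k IHk]; last by rewrite exprS; exact: reaches_tens_map.
have one : (1%:M : 'M[C]_1) *m (1%:M) ^t* = 1%:M.
  by rewrite trmx1 map_mx1 mulmx1.
exists (fun=> 1%:M), (fun=> 1%:M); split=> [y||] /=; rewrite ?big_ord1 ?one //.
  by rewrite mxtrace1.
by rewrite mulmx1 mxtrace1.
Qed.

(* The states are the two spectral projectors of the reflection [S]; the POVM
   elements are the same projectors, in the same or in the opposite order. *)
Lemma reaches_reflection (N : {linear 'M[C]_2 -> 'M[C]_2}) (S : 'M[C]_2) (l : C)
    (b : bool) :
  S ^t* = S -> S *m S = 1%:M -> \tr S = 0 -> N 1%:M = 1%:M -> N S = l *: S ->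
  reaches N (1 + (-1) ^+ b * l).
Proof.
move=> Sh SS trS N1 NS.
(* The projector onto the eigenspace of [S] for $(-1)^b$, of rank one since [S] is traceless. *)
pose P (b : bool) : 'M[C]_2 := 2^-1 *: (1%:M + (-1) ^+ b *: S).
have prodE (x y : C) : (1%:M + x *: S) *m (1%:M + y *: S) =
    (1 + x * y) *: 1%:M + (x + y) *: S.
  rewrite mulmxDl !mulmxDr !mul1mx mulmx1 -scalemxAl -scalemxAr SS.
  by apply/matrixP => i j; rewrite !mxE; ring.
have P_gram c : P c *m (P c) ^t* = P c.
  have -> : (P c) ^t* = P c.
    apply/matrixP => i j; have := congr1 (fun A : 'M[C]_2 => A i j) Sh.
    rewrite !mxE rmorphM rmorphD rmorphM fmorphV rmorph_nat rmorph_sign /= => ->.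
    by rewrite conjC_nat eq_sym.
  rewrite /P -scalemxAl -scalemxAr prodE -expr2 sqrr_sign.
  apply/matrixP => i j; rewrite !mxE.
  by move: ((i == j)%:R) ((-1) ^+ c) (S i j) => x y z; field.
have trP c : \tr (P c) = 1.
  by rewrite mxtraceZ mxtraceD mxtrace1 mxtraceZ trS mulr0 addr0 mulVf ?pnatr_eq0.
have sumP : P false + P true = 1%:M.
  apply/matrixP => i j; rewrite !mxE expr0 expr1; move: ((i == j)%:R) (S i j) => x z.
  by field.
have trE c c' : \tr (P c *m N (P c')) = 2^-1 * (1 + (-1) ^+ c * (-1) ^+ c' * l).
  have -> : N (P c') = 2^-1 *: (1%:M + ((-1) ^+ c' * l) *: S).
    by rewrite /P linearZ linearD linearZ /= N1 NS scalerA.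
  rewrite /P -scalemxAl -scalemxAr prodE.
  by rewrite !mxtraceZ mxtraceD !mxtraceZ trS mxtrace1; field.
(* Both outcomes get the trace $(1+(-1)^b l)/2$; swapping the outcomes turns a negative [l] into a
   gain. *)
clearbody P; exists (fun y : 'I_2 => P (y == 1)), (fun y : 'I_2 => P (b (+) (y == 1))).
split=> [y||]; first by rewrite P_gram trP.
  under eq_bigr do rewrite P_gram.
  by rewrite big_ord_recl big_ord1 /=; case: b => //=; rewrite addrC.
under eq_bigr do rewrite !P_gram trE.
by rewrite big_ord_recl big_ord1 /=; case: b => /=; field.
Qed.

Lemma pauli_channel_unital (p0 p1 p2 p3 : R) : p0 + p1 + p2 + p3 = 1 ->
  pauli_channel p0 p1 p2 p3 1%:M = 1%:M.
Proof.
move=> sum_p; rewrite pauli_channelE.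
under eq_bigr do rewrite mulmx1 pauli_unitary.
rewrite -scaler_suml !big_cons big_nil /= -[RHS]scale1r; congr (_ *: _).
by rewrite addr0 -!rmorphD /= !addrA sum_p.
Qed.

End CommunicationValue.

(** * Eigenvalues of the channel, exact value on tensor powers, and the limit *)

Section PauliCapacity.
Variable R : realType.
Local Notation C := R[i].

(** Conjugation by a Pauli matrix fixes those commuting with it and negates the others, whence the
    signs. The entry at 0 is a placeholder. *)
Lemma pauli_channel_eigen (p0 p1 p2 p3 : R) j : (0 < j < 4)%N ->
  pauli_channel p0 p1 p2 p3 (pauli R j) =
  (nth 0 [:: 0; p0 + p1 - p2 - p3; p0 + p2 - p1 - p3; p0 + p3 - p1 - p2] j)%:C%C
    *: pauli R j.
Proof.
case: j => [|[|[|[|//]]]] // _; rewrite /pauli_channel /pauli /=;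
  apply/matrixP => k l; rewrite !mxE !big_ord_recl !big_ord0 !mxE;
  rewrite !big_ord_recl !big_ord0 !mxE;
  case: k => [[|[|//]] ?]; case: l => [[|[|//]] ?] //=;
  apply/eqP; rewrite eq_complex /=; apply/andP; split; apply/eqP; ring.
Qed.

Lemma mxtrace_pauli j : (0 < j < 4)%N -> \tr (pauli R j) = 0.
Proof.
case: j => [|[|[|[|//]]]] // _; rewrite /mxtrace !big_ord_recl big_ord0 /pauli;
  by rewrite !mxE /= addr0 ?addr0 ?subrr.
Qed.

(** Let $\sigma_j$ be proportional to $\sigma_a\sigma_b$, with eigenvalue $\lambda_j$. If one of
    $a,b$ is 0, then $\lambda_j=2(p_a+p_b)-1$; otherwise both anticommute with $\sigma_j$ and
    $\lambda_j=1-2(p_a+p_b)$. The flag [s] absorbs the sign. *)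
Lemma reaches_pauli (p0 p1 p2 p3 : R) (a b : nat) : p0 + p1 + p2 + p3 = 1 ->
  (a < 4)%N -> (b < 4)%N -> a != b ->
  let p := nth 0 [:: p0; p1; p2; p3] in
  reaches (pauli_channel p0 p1 p2 p3) (2 * (p a + p b))%:C%C.
Proof.
move=> sum_p a4 b4 ab p.
have H j (s : bool) : (0 < j < 4)%N -> 2 * (p a + p b) = 1 + (-1) ^+ s *
    nth 0 [:: 0; p0 + p1 - p2 - p3; p0 + p2 - p1 - p3; p0 + p3 - p1 - p2] j ->
    reaches (pauli_channel p0 p1 p2 p3) (2 * (p a + p b))%:C%C.
  move=> j4 ->; rewrite rmorphD rmorphM rmorph_sign rmorph1.
  apply: reaches_reflection (pauli_herm R j) _ (mxtrace_pauli j4)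
    (pauli_channel_unital sum_p) (pauli_channel_eigen _ _ _ _ j4).
  by rewrite -{2}pauli_herm pauli_unitary.
have {sum_p} p0E : p0 = 1 - p1 - p2 - p3 by rewrite -sum_p; ring.
subst p0; rewrite /p in H *; clear p.
case: a b a4 b4 ab H => [|[|[|[|//]]]] [|[|[|[|//]]]] //= _ _ _ H;
  first [ by apply: (H 1 false) => //=; ring | by apply: (H 1 true) => //=; ring
        | by apply: (H 2 false) => //=; ring | by apply: (H 2 true) => //=; ring
        | by apply: (H 3 false) => //=; ring | by apply: (H 3 true) => //=; ring ].
Qed.

Lemma pow_dimE d k : pow_dim d k = (d ^ k)%N.
Proof. by elim: k => // k IHk; rewrite expnS -IHk. Qed.

Lemma cv_pauli_tens_pow (p0 p1 p2 p3 : R) k :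
  0 <= p0 -> 0 <= p1 -> 0 <= p2 -> 0 <= p3 -> p0 + p1 + p2 + p3 = 1 ->
  let q := sort >=%R [:: p0; p1; p2; p3] in
  cv (tens_pow (pauli_channel p0 p1 p2 p3) k) = (2 * (nth 0 q 0 + nth 0 q 1)) ^+ k.
Proof.
move=> p0_ge0 p1_ge0 p2_ge0 p3_ge0 sum_p q.
have Lq := @stable_bound_tens_pow _ _ _ _ _ k p0_ge0 p1_ge0 p2_ge0 p3_ge0.
have [a [b [c [f /= [perm _ _ _ qE]]]]] := sorted_weightsP p0 p1 p2 p3.
rewrite /q; rewrite qE /= in Lq *.
set p := nth 0 _ in Lq qE *.
have ltn4 i : i \in [:: a; b; c; f] -> (i < 4)%N.
  by rewrite (perm_mem perm) !inE => /or4P[] /eqP->.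
have a4 : (a < 4)%N by apply: ltn4; rewrite inE eqxx.
have b4 : (b < 4)%N by apply: ltn4; rewrite !inE eqxx orbT.
have ab : a != b.
  by have := perm_uniq perm; rewrite /= !inE !negb_or => /andP[/andP[]].
have p_ge0 i : 0 <= p i by do 4?[case: i => [|i] //]; rewrite /p /= nth_nil.
have ub := stable_bound_cv_values (exprn_ge0 k (addr_ge0 (p_ge0 a) (p_ge0 b))) Lq.
(* The output dimension $2^k$ turns the stable bound into exactly the value reached by the product
   code. *)
have dimE : (pow_dim 2 k)%:R = 2 ^+ k :> R by rewrite pow_dimE natrX.
rewrite dimE -exprMn mulrC in ub.
have := reaches_tens_pow k (reaches_pauli sum_p a4 b4 ab).
rewrite -rmorphXn => /reaches_cv_values[|v cv_v le_v].
  by rewrite pow_dimE expn_gt0.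
apply/eqP; rewrite eq_le; apply/andP; split.
  by apply: ge_sup ub; exists v.
by apply: le_trans le_v _; apply: ub_le_sup cv_v; exists ((2 * (p a + p b)) ^+ k).
Qed.

End PauliCapacity.

Local Close Scope sesquilinear_scope.

Theorem mainTheorem10 (R : realType) (p0 p1 p2 p3 : R)
  (p0_ge0 : 0 <= p0) (p1_ge0 : 0 <= p1) (p2_ge0 : 0 <= p2) (p3_ge0 : 0 <= p3)
  (sum_p : p0 + p1 + p2 + p3 = 1) :
  let q := sort >=%R [:: p0; p1; p2; p3] in
  let q1 := nth 0 q 0 in
  let q2 := nth 0 q 1 in
  cvg (cv_rate (pauli_channel p0 p1 p2 p3) @ \oo) /\
  cv_capacity (pauli_channel p0 p1 p2 p3) = log2 (2 * (q1 + q2)).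
Proof.
(* The two largest weights carry at least half of the total, so the logarithm has a positive
   argument. *)
move=> q q1 q2; have q12_gt0 : 0 < 2 * (q1 + q2).
  rewrite /q1 /q2 /q.
  have [a [b [c [f /= [perm ba cb fc ->]]]]] := sorted_weightsP p0 p1 p2 p3.
  set p := nth 0 _ in ba cb fc *.
  have : \sum_(i <- iota 0 4) p i = 1 by rewrite !big_cons big_nil -sum_p /p /=; ring.
  rewrite -(perm_big _ perm) !big_cons big_nil /= => sum1.
  by lra.
suff lim_rate : cv_rate (pauli_channel p0 p1 p2 p3) @ \oo --> log2 (2 * (q1 + q2)).
  by split; [exact: cvgP lim_rate | exact: cvg_lim lim_rate].
(* The rate is constant from [k = 1] on; at [k = 0] it is 0, because $0^{-1}=0$. *)
apply: cvg_near_cst; near=> k.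
rewrite /cv_rate cv_pauli_tens_pow // /log2 lnXn //.
rewrite -[ln _ *+ k]mulr_natl -mulrA mulKf //.
by rewrite pnatr_eq0 -lt0n; near: k; exact: nbhs_infty_gt.
Unshelve. all: by end_near.
Qed.
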